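(* Let $I=[a,b]$ be a compact interval, let $(X,d)$ be a metric space, let $g:I\to\mathbb R$ be an arbitrary function, and let $F:I\to\mathcal K(X)$. Suppose that, for some $\alpha\ge1$ and $L\ge0$, $$d_H(F(s),F(t))\le L|g(t)-g(s)|^\alpha\qquad\text{for all } s,t\in I.$$ Then, for every $\theta\in I$ and every $x_\theta\in F(\theta)$, there exists a map $f:I\to X$ with $f(t)\in F(t)$ for every $t\in I$, such that $f(\theta)=x_\theta$ and $$d(f(s),f(t))\le L|g(t)-g(s)|^\alpha\qquad\text{for all } s,t\in I.$$ Consequently, if $L=[F]_{\alpha,g}$, then $[f]_{\alpha,g}\le[F]_{\alpha,g}$.
   Context: $\mathcal K(X)$ is the family of all nonempty compact subsets of $X$, and $d_H$ is the Hausdorff distance on $\mathcal K(X)$ induced by $d$. For $\alpha>0$, $F:I\to\mathcal K(X)$ is called $g$-Hölder of exponent $\alpha$ if there is $L\ge0$ with $d_H(F(s),F(t))\le L|g(t)-g(s)|^\alpha$ for all $s,t\in I$; then $[F]_{\alpha,g}$ denotes the minimum such $L$. For single-valued $f:I\to X$, $[f]_{\alpha,g}$ is the minimum $L\ge0$ with $d(f(s),f(t))\le L|g(t)-g(s)|^\alpha$ for all $s,t\in I$. *)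

(* Defs.v *)
From mathcomp Require Import all_boot all_order all_algebra.
From mathcomp Require Import all_classical all_reals all_analysis.

Set Implicit Arguments.
Unset Strict Implicit.
Unset Printing Implicit Defensive.

Import Order.TTheory GRing.Theory Num.Theory.
Import numFieldNormedType.Exports.

Local Open Scope classical_set_scope.
Local Open Scope ring_scope.

Definition nonempty_compacts (X : topologicalType) : set (set X) :=
  [set A | A !=set0 /\ compact A].

(* [inf] and [sup] are the real-valued ones, with junk values on empty or
   unbounded sets; neither case occurs when A and B are nonempty and compact. *)
Definition hausdorff_dist (R : realType) (X : metricType R) (A B : set X) : R :=
  Num.max (sup [set inf [set mdist x y | y in B] | x in A])
          (sup [set inf [set mdist x y | x in A] | y in B]).

(* Maps on a subset D of R are total functions of which only the values on D
   matter. Taking [rho := mdist] gives the single-valued notion, and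
   [rho := @hausdorff_dist R X] the set-valued one. *)
Definition holder_constants (R : realType) (T : Type) (rho : T -> T -> R)
    (D : set R) (alpha : R) (g : R -> R) (F : R -> T) : set R :=
  [set L | 0 <= L /\
     forall s t, D s -> D t -> rho (F s) (F t) <= L * `|g t - g s| `^ alpha].

(* The least Hoelder constant; the default value 0 is used only when F is not
   Hoelder, see [holder_constP]. *)
Definition holder_const (R : realType) (T : Type) (rho : T -> T -> R)
    (D : set R) (alpha : R) (g : R -> R) (F : R -> T) : R :=
  let C := holder_constants rho D alpha g F in
  xget 0 [set L | C L /\ lbound C L].

Lemma holder_constP (R : realType) (T : Type) (rho : T -> T -> R)
    (D : set R) (alpha : R) (g : R -> R) (F : R -> T) :
  holder_constants rho D alpha g F !=set0 ->
  holder_constants rho D alpha g F (holder_const rho D alpha g F) /\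
  lbound (holder_constants rho D alpha g F) (holder_const rho D alpha g F).
Proof.
rewrite /holder_const; set C := holder_constants _ _ _ _ _ => C0.
have lbC : has_lbound C by exists 0 => L [].
suff Cmin : C (inf C) /\ lbound C (inf C).
  exact: (@xgetPex _ 0 [set L | C L /\ lbound C L] (ex_intro _ _ Cmin)).
split; last by move=> L CL; exact: ge_inf.
split=> [|s t Ds Dt]; first by apply: lb_le_inf => // L [].
have := powR_ge0 `|g t - g s| alpha; rewrite le_eqVlt => /predU1P[p0|p_gt0].
  by have [L [_ /(_ s t Ds Dt)]] := C0; rewrite -p0 !mulr0.
rewrite -ler_pdivrMr//; apply: lb_le_inf => // L [_ /(_ s t Ds Dt)].
by rewrite ler_pdivrMr.
Qed.

(* Main.v *)
Require Import Defs.
From mathcomp Require Import all_boot all_order all_algebra.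
From mathcomp Require Import all_classical all_reals all_analysis.
From mathcomp Require Import lra.

(** A nearest-point chain, started at [theta] and followed in the order of [g],
    gives a selection on any finite set of parameters: consecutive points obey
    the Hoelder bound, and since [x `^ alpha] is superadditive for
    [1 <= alpha], the triangle inequality propagates the bound, with the same
    constant, to all pairs. By Tychonoff's theorem the product of the [F t] is
    compact, and a cluster point of the finite selections is a global one. *)

Import Order.TTheory GRing.Theory Num.Theory.
Import numFieldNormedType.Exports.

Local Open Scope classical_set_scope.
Local Open Scope ring_scope.

(** Write each power as [x * x]^ (p - 1)[; since]0 <= p - 1[, both factors]x [^ (p - 1)] and [y]^ (p
    - 1)[are at most](x + y) [^ (p - 1)]. *)
Lemma powR_superadditive (R : realType) (p x y : R) :
  1 <= p -> 0 <= x -> 0 <= y -> x `^ p + y `^ p <= (x + y) `^ p.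
Proof.
move=> p1 x0 y0; have p0 : 0 < p by rewrite (lt_le_trans _ p1).
rewrite -(mulr_powRB1 x0 p0) -(mulr_powRB1 y0 p0).
rewrite -(mulr_powRB1 (addr_ge0 x0 y0) p0) mulrDl.
by apply: lerD; apply: ler_wpM2l => //; apply: ge0_ler_powR;
  rewrite ?nnegrE ?subr_ge0 ?addr_ge0// ?lerDl ?lerDr.
Qed.

Section metric.
Context {R : realType} {X : metricType R}.
Implicit Types (A B : set X) (x y : X).

Lemma near_mdist_lt x (e : R) : 0 < e -> nbhs x [set y | mdist x y < e].
Proof. by move=> e0; rewrite -ballEmdist; exact: nbhsx_ballx. Qed.

Lemma continuous_mdistr x : continuous (fun y => mdist x y : R).
Proof.
move=> y; apply/(@cvgrPdist_lt _ R^o) => e e0.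
apply: filterS (near_mdist_lt y _ e0) => z /= yz.
have h1 := metric_triangle x y z; have h2 := metric_triangle x z y.
rewrite (metric_sym z) in h2.
by rewrite ltr_norml; apply/andP; split; lra.
Qed.

Lemma compact_mdist_min A x : nonempty_compacts A ->
  exists2 y, A y & forall z, A z -> mdist x y <= mdist x z.
Proof.
move=> [A0 cA].
have [|y /set_mem Ay ymin] := @compact_EVT_min _ R (mdist x) A A0 cA.
  exact/continuous_subspaceT/continuous_mdistr.
by exists y => // z /mem_set; exact: ymin.
Qed.

Lemma hausdorff_dist_attained A B x :
  nonempty_compacts A -> nonempty_compacts B -> A x ->
  exists2 y, B y & mdist x y <= hausdorff_dist A B.
Proof.
move=> [A0 cA] cptB Ax; have [y By ymin] := compact_mdist_min B x cptB.
exists y => //; rewrite /hausdorff_dist le_max; apply/orP; left.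
have lbB z : has_lbound [set mdist z w | w in B].
  by exists 0 => _ [w _ <-]; exact: mdist_ge0.
apply: (@le_trans _ _ (inf [set mdist x w | w in B])).
  by apply: lb_le_inf => [|_ [w Bw <-]]; [exists (mdist x y), y|exact: ymin].
(* The [sup] is not a junk value: the distance from a point of [A] to [B] is at most its distance to
   the fixed point [y], which is bounded on the compact set [A]. *)
apply: ub_le_sup; last by exists x.
have [|c _ cmax] := @compact_EVT_max _ R (mdist y) A A0 cA.
  exact/continuous_subspaceT/continuous_mdistr.
exists (mdist y c) => _ [z Az <-].
apply: (@le_trans _ _ (mdist z y)); first by apply: ge_inf => //; exists y.
by rewrite metric_sym; apply: cmax; exact: mem_set.
Qed.

Lemma compact_selection (T : eqType) (A : T -> set X) (c : T -> T -> R) :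
  (forall t, compact (A t)) ->
  (forall s : seq T, exists2 f, forall t, A t (f t) &
     {in s &, forall t u, mdist (f t) (f u) <= c t u}) ->
  exists2 f, forall t, A t (f t) & forall t u, mdist (f t) (f u) <= c t u.
Proof.
move=> cA fin.
(* These sets form a filter base, because [B (s1 ++ s2)] lies in both [B s1] and [B s2]. *)
pose B (s : seq T) := [set f : T -> X | (forall t, A t (f t)) /\
  {in s &, forall t u, mdist (f t) (f u) <= c t u}].
pose G := filter_from [set: seq T] B.
have GF : Filter G.
  apply: filter_from_filter; first by exists [::].
  move=> s1 s2 _ _; exists (s1 ++ s2) => // f [Af fc].
  by split; split=> // t u ts us; apply: fc; rewrite mem_cat ?ts ?us ?orbT.
have GP : ProperFilter G.
  by apply: filter_from_proper => s _; have [f Af fc] := fin s; exists f.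
have GA : G [set f | forall t, A t (f t)] by exists [::] => // f [].
have [f [/= Af clf]] := @tychonoff T (fun=> X) A cA G GP GA.
(* The bound survives in the limit: some [h] in [B [:: t; u]] is within [e / 2] of [f] at both [t]
   and [u], so passing from [h] to [f] costs less than [e]. *)
exists f => // t u; apply/ler_addgt0Pr => e e0.
have e20 : 0 < e / 2 by rewrite divr_gt0.
have nearf v : nbhs (f : prod_topology (fun=> X))
    [set h : T -> X | mdist (f v) (h v) < e / 2].
  exact: (@proj_continuous T (fun=> X) v f _ (near_mdist_lt (f v) _ e20)).
have near_tu := @filterI _ _
  (@nbhs_filter (prod_topology (fun _ : T => X)) f) _ _ (nearf t) (nearf u).
have [|h [[_ hc] [/= ht hu]]] := clf (B [:: t; u]) _ _ near_tu.
  by exists [:: t; u].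
have := hc t u; rewrite !inE !eqxx orbT => /(_ isT isT) htu.
have h1 := metric_triangle (f t) (h t) (f u).
have h2 := metric_triangle (h t) (h u) (f u).
by rewrite (metric_sym (h u)) in h2; lra.
Qed.

End metric.

Lemma seq_argmin {R : realType} {T : eqType} (h : T -> R) (x0 : T) (s : seq T) :
  exists2 p, p \in x0 :: s & {in x0 :: s, forall t, h p <= h t}.
Proof.
elim: s x0 => [|x1 s IH] x0.
  by exists x0 => [|t]; rewrite inE// => /eqP->.
have [p ps pmin] := IH x1; have [le_xp|lt_px] := leP (h x0) (h p).
  exists x0 => [|t]; first exact: mem_head.
  by rewrite inE => /predU1P[->//|/pmin]; exact: le_trans.
by exists p => [|t]; rewrite inE ?ps ?orbT// => /predU1P[->|/pmin//]; exact: ltW.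
Qed.

(** Being farthest from [c], [m] has [p] and [t] on the same side, towards [c]; being nearer to [m],
    [p] then lies between [m] and [t]. *)
Lemma dist_extremal (R : realFieldType) (c m p t : R) :
  `|t - c| <= `|m - c| -> `|p - c| <= `|m - c| -> `|m - p| <= `|m - t| ->
  `|m - t| = `|p - t| + `|m - p|.
Proof.
have [cm|mc] := ger0P (m - c); rewrite !ler_norml => /andP[t1 t2] /andP[p1 p2].
- rewrite (@ger0_norm _ (m - p)) ?(@ger0_norm _ (m - t)); [|lra..].
  by move=> pt; rewrite ger0_norm; lra.
- rewrite (@ler0_norm _ (m - p)) ?(@ler0_norm _ (m - t)); [|lra..].
  by move=> pt; rewrite ler0_norm; lra.
Qed.

Section finite_selection.
Context {R : realType} {X : metricType R} {T : eqType}.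
Variables (F : T -> set X) (g : T -> R) (alpha L : R).
Hypotheses (alpha1 : 1 <= alpha) (L0 : 0 <= L).
Hypothesis F_near : forall s t x, F s x ->
  exists2 y, F t y & mdist x y <= L * `|g t - g s| `^ alpha.
Variables (theta : T) (x : X).
Hypothesis Fx : F theta x.

Let holder_on (s : seq T) (f : T -> X) :=
  {in s &, forall t u, mdist (f t) (f u) <= L * `|g u - g t| `^ alpha}.

(* Adding the parameters by increasing [`|g t - g theta|] makes each new one
   extremal for [g], so that the nearest old parameter [p] lies between it and
   all the others. *)
Let finite_selection_sorted (s : seq T) :
  sorted (fun t u => `|g u - g theta| <= `|g t - g theta|) s ->
  exists f, [/\ forall t, F t (f t), f theta = x & holder_on (theta :: s) f].
Proof.
elim: s => [_|m s IH ms].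
  have /choice[f fP] t : exists y, F t y /\ (t = theta -> y = x).
    have [->|/eqP tNtheta] := eqVneq t theta; first by exists x.
    by have [y Fy _] := F_near theta t x Fx; exists y.
  exists f; split=> [t||t u]; [exact: (fP t).1|exact: (fP theta).2|].
  rewrite !inE => /eqP-> /eqP->; rewrite mdistxx.
  by rewrite mulr_ge0 ?powR_ge0.
(* The list is sorted by decreasing distance, so its head [m] is the parameter added last. *)
have far_m : {in theta :: s, forall t, `|g t - g theta| <= `|g m - g theta|}.
  move=> t; rewrite inE => /predU1P[->|ts]; first by rewrite subrr normr0.
  apply: (allP (order_path_min _ ms)) => // u v w /= h1 h2.
  exact: le_trans h2 h1.
have [f [Ff fx fH]] := IH (path_sorted ms).
(* A repeated parameter keeps the value it already has. *)
have [ms'|mNs] := boolP (m \in theta :: s).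
  by exists f; split=> // t u tms ums; apply: fH; [move: tms|move: ums];
    rewrite !inE => /or3P[] // => [->//|/eqP->//|->]; rewrite orbT.
have [p ps pmin] := seq_argmin (fun t => `|g m - g t|) theta s.
have [y Fy yp] := F_near p m (f p) (Ff p).
(* Go from [f t] to [y] through [f p]: as [g p] lies between [g t] and [g m], superadditivity merges
   the two bounds without enlarging [L]. *)
have ym t : t \in theta :: s -> mdist (f t) y <= L * `|g m - g t| `^ alpha.
  move=> ts; apply: (le_trans (metric_triangle _ (f p) _)).
  apply: (le_trans (lerD (fH _ _ ts ps) yp)); rewrite -mulrDr ler_wpM2l//.
  apply: (le_trans (powR_superadditive _ _ _ _ alpha1 _ _)) => //.
  by rewrite (dist_extremal _ _ _ _ _ (far_m t ts) (far_m p ps) (pmin t ts)).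
exists (fun t => if t == m then y else f t); split=> [t||t u].
- by case: eqP => [->|].
- by case: eqP mNs => // <-; rewrite mem_head.
have memP v : v \in [:: theta, m & s] -> v != m -> v \in theta :: s.
  by rewrite !inE => /or3P[] ->; rewrite ?orbT.
move=> /memP ts /memP us.
case: eqVneq ts us => [->|tm] ts; case: eqVneq => [->|um] us.
- by rewrite mdistxx mulr_ge0 ?powR_ge0.
- by rewrite metric_sym distrC; apply: ym; exact: us.
- by apply: ym; exact: ts.
- by apply: fH; [exact: ts|exact: us].
Qed.

Lemma finite_selection (s : seq T) :
  exists f, [/\ forall t, F t (f t), f theta = x & holder_on s f].
Proof.
pose r t u := `|g u - g theta| <= `|g t - g theta|.
have r_total : total r by move=> t u; exact: le_total.
have [f [Ff fx fH]] := finite_selection_sorted _ (sort_sorted r_total s).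
exists f; split=> // t u ts us; apply: fH;
  by rewrite inE mem_sort ?ts ?us orbT.
Qed.

Lemma compact_holder_selection : (forall t, compact (F t)) ->
  exists f, [/\ forall t, F t (f t), f theta = x &
    forall t u, mdist (f t) (f u) <= L * `|g u - g t| `^ alpha].
Proof.
(* Shrinking the factor at [theta] to a singleton forces the limit selection through [x]. *)
move=> cF; pose A t := if t == theta then [set x] else F t.
have AF t y : A t y -> F t y by rewrite /A; case: eqP => // -> ->.
have cA t : compact (A t) by rewrite /A; case: eqP => // _; exact: compact_set1.
pose c t u := L * `|g u - g t| `^ alpha.
have [|f Af fH] := compact_selection _ A c cA.
  move=> s; have [f [Ff fx fH]] := finite_selection s.
  by exists f; [move=> t; rewrite /A; case: eqP => [->|]|exact: fH].
exists f; split=> // [t|]; first exact: AF.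
by have := Af theta; rewrite /A eqxx.
Qed.

End finite_selection.

Theorem theorem5p1 (R : realType) (X : metricType R) (a b : R)
    (g : R -> R) (F : R -> set X) (alpha L : R) :
  let I : set R := `[a, b]%classic in
  a <= b ->
  (forall t, I t -> nonempty_compacts (F t)) ->
  1 <= alpha -> 0 <= L ->
  (forall s t, I s -> I t ->
     hausdorff_dist (F s) (F t) <= L * `|g t - g s| `^ alpha) ->
  forall (theta : R) (x : X), I theta -> F theta x ->
  exists f : R -> X,
    [/\ forall t, I t -> F t (f t),
        f theta = x,
        forall s t, I s -> I t ->
          mdist (f s) (f t) <= L * `|g t - g s| `^ alpha
      & L = holder_const (@hausdorff_dist R X) I alpha g F ->
        holder_const mdist I alpha g f
          <= holder_const (@hausdorff_dist R X) I alpha g F].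
Proof.
move=> I _ cF alpha1 L0 FH theta x Itheta Fx.
(* The parameters are taken in the subtype of [I], where the hypotheses hold everywhere. *)
have F_near (s t : I) y : F (val s) y ->
    exists2 z, F (val t) z & mdist y z <= L * `|g (val t) - g (val s)| `^ alpha.
  have Is := set_valP s; have It := set_valP t => Fy.
  have [z Fz yz] := hausdorff_dist_attained _ _ _ (cF _ Is) (cF _ It) Fy.
  by exists z => //; apply: le_trans yz _; exact: FH.
pose theta' : I := SigSub (mem_set Itheta).
have [|f [Ff fx fH]] :=
    compact_holder_selection _ (g \o val) _ _ alpha1 L0 F_near theta' x Fx.
  by move=> t; case: (cF _ (set_valP t)).
(* Outside [I] the value [x] is an arbitrary default. *)
pose h t := oapp f x (insub t).
have hE t (It : I t) : h t = f (SigSub (mem_set It)).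
  by rewrite /h (insubT (fun t => t \in I) (mem_set It)).
have hH s t : I s -> I t -> mdist (h s) (h t) <= L * `|g t - g s| `^ alpha.
  by move=> Is It; rewrite !hE; exact: fH.
exists h; split=> // [t It||Lmin].
- by rewrite hE; exact: (Ff (SigSub (mem_set It))).
- by rewrite hE.
have hL : holder_constants mdist I alpha g h L by [].
by rewrite -Lmin; apply: (holder_constP (ex_intro _ _ hL)).2.
Qed.
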